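(* Let $X,Y$ be independent real-valued random variables with the same distribution. Then for every real $c>0$, $$P(|X+Y|\le c)<2\,P(|X-Y|\le c).$$ *)

(* Defs.v *)
From HB Require Import structures.
From mathcomp Require Import all_boot all_order all_algebra.
From mathcomp Require Import all_classical all_reals all_analysis.

Set Implicit Arguments.
Unset Strict Implicit.
Unset Printing Implicit Defensive.

Local Open Scope classical_set_scope.
Local Open Scope ereal_scope.

Definition independent_RV2 {d d1 d2} {T : measurableType d}
    {T1 : measurableType d1} {T2 : measurableType d2} {R : realType}
    (P : probability T R) (X : {RV P >-> T1}) (Y : {RV P >-> T2}) : Prop :=
  forall (A : set T1) (B : set T2), measurable A -> measurable B ->
    P (X @^-1` A `&` Y @^-1` B) = P (X @^-1` A) * P (Y @^-1` B).

(* The laws are compared on measurable sets only: [distribution P X] is total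
   on [set T'], and its values on non-measurable sets carry no meaning. *)
Definition identically_distributed {d d'} {T : measurableType d}
    {T' : measurableType d'} {R : realType}
    (P : probability T R) (X Y : {RV P >-> T'}) : Prop :=
  forall A : set T', measurable A -> distribution P X A = distribution P Y A.

(* Main.v *)
Require Import Defs.
From HB Require Import structures.
From mathcomp Require Import all_boot all_order all_algebra.
From mathcomp Require Import all_classical all_reals all_analysis.
From mathcomp Require Import measurable_realfun lra ring.

Set Implicit Arguments.
Unset Strict Implicit.
Unset Printing Implicit Defensive.

(** Let nu be the common law and write f x for the nu-mass of [x - c, x + c].
Conditioning on X gives P(|X - Y| <= c) = int f(x) dnu and
P(|X + Y| <= c) = int f(-x) dnu, so the claim is that the energy
D(nu) = int k dnu, with k(x) = 2 f(x) - f(-x), is positive for every probability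
nu on the line. The proof is variational. D is a quadratic form in nu, and for a
mixture with a point mass
[D((1-e) nu + e delta_a) = (1-e)^2 D(nu) + 2 e (1-e) k(a) + O(e^2)]
([energy_mixture_le]); hence at a minimiser of D over all probabilities, k is
bounded below by D(nu), its own average, at every point.

Let t be the supremum of the masses of closed intervals of length c ([peak]).
Two geometric facts drive everything. An interval of length 2c is covered by two
intervals of length c, so f(-x) <= 2t. If x lies in an interval I of length c
then I is contained in [x - c, x + c], so f(x) >= nu(I), whence
k(x) >= 2 nu(I) - 2t.

- D >= 0 ([energy_ge0]). Suppose the infimum l of D is negative and take nu nearly
  minimal. Then k is almost at least l everywhere, but is almost nonnegative on an
  interval I with nu(I) close to t. As the average of k is about l, I must have
  small mass; so t is small, and k >= -2t forces D(nu) to be near 0.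

- D > 0 ([energy_gt0]). If D(nu) = 0 then nu is a minimiser, so k >= 0 and k = 0
  almost everywhere. The value t is attained, and among the centers m of intervals
  of mass t one has maximal absolute value, say m >= 0 ([peak_attained_far]). A
  point x of that interval with k(x) = 0 has f(-x) = 2 f(x) >= 2t, so both
  halves of [-x - c, -x + c] have mass t. Their centers -x - c/2 and -x + c/2
  cannot exceed m in absolute value, so x = m - c/2, and the first half is the
  interval centered at -m. The same reasoning applied to it shows that its only
  point where k = 0 is its right end -x, so all its mass t sits at the common
  endpoint of the two halves. That mass is then counted twice, and f(-x) <= t,
  a contradiction. *)

Import Order.TTheory GRing.Theory Num.Theory.
Import numFieldNormedType.Exports.

Local Open Scope classical_set_scope.
Local Open Scope ring_scope.

(** * Probabilities with real values *)

Section real_valued_probability.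
Context {R : realType} {d : measure_display} {T : measurableType d}.
Variable P : probability T R.
Implicit Types A B : set T.

Lemma prob_fineK A : measurable A -> (fine (P A))%:E = P A.
Proof. by move=> mA; rewrite fineK// fin_num_measure. Qed.

Lemma prob_ge0 A : 0 <= fine (P A).
Proof. exact: fine_ge0. Qed.

Lemma prob_le1 A : measurable A -> fine (P A) <= 1.
Proof. by move=> mA; rewrite -lee_fin prob_fineK// probability_le1. Qed.

Lemma prob_mono A B : measurable A -> measurable B -> A `<=` B ->
  fine (P A) <= fine (P B).
Proof.
move=> mA mB AB; rewrite -lee_fin !prob_fineK//.
by apply: le_measure; rewrite ?inE.
Qed.

Lemma prob_cover2 A B C : measurable A -> measurable B -> measurable C ->
  A `<=` B `|` C -> fine (P A) <= fine (P B) + fine (P C).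
Proof.
move=> mA mB mC ABC; rewrite -lee_fin EFinD !prob_fineK//.
apply: le_trans (measureU2 _ mB mC).
by apply: le_measure; rewrite ?inE//; exact: measurableU.
Qed.

Lemma bounded_integrable (g : T -> R) (M : R) : measurable_fun setT g ->
  (forall x, `|g x| <= M) -> P.-integrable setT (EFin \o g).
Proof.
move=> mg gM; apply: measurable_bounded_integrable => //.
  by rewrite (le_lt_trans (probability_le1 P measurableT))// ltry.
exists M; split; first exact: num_real.
by move=> r /ltW Mr x _ /=; apply: le_trans Mr.
Qed.

Lemma Rintegral_prob_cst (r : R) : \int[P]_x r = r.
Proof.
rewrite Rintegral_cst// -[RHS]mulr1; congr (r * _).
by have := congr1 (@fine R) (probability_setT P).
Qed.

(** Continuity from above, in the form in which it is used: a strict upper bound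
on the mass of a decreasing intersection already holds at a finite stage. *)
Lemma prob_bigcap_lt (F : (set T)^nat) (b : R) :
    (forall n, measurable (F n)) -> nonincreasing_seq F ->
    fine (P (\bigcap_n F n)) < b ->
  exists n, fine (P (F n)) < b.
Proof.
move=> mF ndF lt_b.
have mI : measurable (\bigcap_n F n) by exact: bigcap_measurable.
have cvgP : P \o F @ \oo --> P (\bigcap_n F n).
  apply: nonincreasing_cvg_mu => //.
  by rewrite (le_lt_trans (probability_le1 _ _))// ltry.
rewrite -(prob_fineK mI) in cvgP.
have /fine_cvgP[_ /cvgr_lt/(_ _ lt_b)[n _ nb]] := cvgP.
by exists n; exact: (nb n (leqnn n)).
Qed.

End real_valued_probability.

(** * Mixing a probability with a point mass *)

Section mixture.
Context {R : realType} {d : measure_display} {T : measurableType d}.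
Variables (e : R) (e0 : 0 <= e) (e1 : 0 <= 1 - e).
Variables (nu : probability T R) (a : T).

Definition mixture : set T -> \bar R :=
  measure_add (mscale (NngNum e1) nu) (mscale (NngNum e0) \d_a).

HB.instance Definition _ := Measure.on mixture.

Let mixture_setT : mixture setT = 1%E.
Proof.
rewrite /mixture measure_addE.
transitivity ((1 - e)%:E * 1 + e%:E * 1 : \bar R)%E; last first.
  by rewrite !mule1 -EFinD subrK.
by congr (_ * _ + _ * _)%E; [exact: probability_setT|exact: diracT].
Qed.

HB.instance Definition _ :=
  Measure_isProbability.Build _ _ _ mixture mixture_setT.

Lemma mixtureE A : measurable A ->
  fine (mixture A) = (1 - e) * fine (nu A) + e * \1_A a.
Proof.
move=> mA; rewrite /mixture measure_addE.
change (fine ((1 - e)%:E * nu A + e%:E * \d_a A)%E =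
  (1 - e) * fine (nu A) + e * \1_A a).
by rewrite -(prob_fineK nu mA).
Qed.

(** Sums and multiples of measures are compatible with integrals of nonnegative
functions; a bounded g is reduced to g + M, since on every probability the
integral changes by exactly M. *)
Lemma Rintegral_mixture (g : T -> R) (M : R) : measurable_fun setT g ->
    (forall x, `|g x| <= M) ->
  \int[mixture]_x g x = (1 - e) * \int[nu]_x g x + e * g a.
Proof.
move=> mg gM.
have mgM : measurable_fun setT (fun x => g x + M) by apply: measurable_funD.
have gM0 x : 0 <= g x + M.
  by have := gM x; rewrite ler_norml -subr_ge0 opprK addrC => /andP[+ _].
have shift (m : probability T R) : \int[m]_x g x = \int[m]_x (g x + M) - M.
  rewrite RintegralD//; first by rewrite Rintegral_prob_cst addrK.
    exact: bounded_integrable gM.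
  by apply: (@bounded_integrable _ _ _ _ _ (`|M|)).
rewrite !shift; rewrite {1}/Rintegral ge0_integral_measure_add//; last first.
- exact/measurable_EFinP.
- by move=> x _; rewrite lee_fin.
rewrite !ge0_integral_mscale//; try exact/measurable_EFinP;
  try by move=> x _; rewrite lee_fin.
rewrite integral_dirac//; last exact/measurable_EFinP.
rewrite diracT mul1e /=.
have fint : (\int[nu]_x (g x + M)%:E)%E \is a fin_num.
  apply: integrable_fin_num => //; apply: (@bounded_integrable _ _ _ _ _ (M + M)) => //.
  move=> x; rewrite ger0_norm// lerD2r; exact: le_trans (ler_norm _) (gM x).
rewrite -(fineK fint) -!EFinM -EFinD /= -/(Rintegral _ _ _).
by rewrite /Rintegral; ring.
Qed.

End mixture.

(** * Concentration functions and the energy *)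

Lemma measurable_norm_le {R : realType} {d} {T : measurableType d} (f : T -> R)
    (c : R) : measurable_fun setT f -> measurable [set x | `|f x| <= c].
Proof.
move=> mf; have mnf : measurable_fun setT (fun x => `|f x|).
  exact: measurableT_comp (@normr_measurable _ _) mf.
have := mnf measurableT _ (measurable_itv `]-oo, c]).
by rewrite setTI set_itvE; congr measurable.
Qed.

Section concentration.
Context {R : realType}.
Implicit Types (nu : probability R R) (r m x c : R).

Definition window m r : set R := [set y | `|y - m| <= r].

Lemma measurable_window m r : measurable (window m r).
Proof. by apply: measurable_norm_le; exact: measurable_funB. Qed.
Hint Resolve measurable_window : core.

Definition conc nu r m : R := fine (nu (window m r)).

Lemma conc_ge0 nu r m : 0 <= conc nu r m.
Proof. exact: prob_ge0. Qed.

Lemma conc_le1 nu r m : conc nu r m <= 1.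
Proof. exact: prob_le1. Qed.

Lemma conc_sub nu r r' m m' : `|m - m'| <= r' - r -> conc nu r m <= conc nu r' m'.
Proof.
move=> mm'; apply: prob_mono => // y; rewrite /window /= => ym.
by have := ler_distD m y m'; lra.
Qed.

Lemma window_halves z c : window z c `<=`
  window (z - c / 2) (c / 2) `|` window (z + c / 2) (c / 2).
Proof.
move=> y; rewrite /window /= !ler_norml => /andP[zy yz].
by have [?|?] := leP y z; [left|right]; apply/andP; split; lra.
Qed.

(** Both halves contain the midpoint z, so an atom at z is counted twice on the
right. *)
Lemma conc_halves nu c z :
  conc nu c z <= conc nu (c / 2) (z - c / 2) + conc nu (c / 2) (z + c / 2).
Proof. by apply: prob_cover2 => //; exact: window_halves. Qed.

(** The windows centered at x are the sections of a measurable subset of the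
plane. *)
Lemma measurable_conc nu r : measurable_fun setT (conc nu r).
Proof.
pose E : set (R * R) := [set p | `|p.2 - p.1| <= r].
have mE : measurable E.
  apply: measurable_norm_le.
  by apply: measurable_funB; [exact: measurable_snd|exact: measurable_fst].
apply: measurableT_comp; first exact: fine_measurable.
have := measurable_fun_xsection nu mE.
congr measurable_fun; apply/funext => x /=; congr (nu _).
by rewrite xsectionE.
Qed.

(** Half the derivative at e = 0 of the energy of (1 - e) nu + e delta_x, up to
the constant - [energy]: the potential at x of the quadratic form [energy]. *)
Definition excess nu c x : R := 2 * conc nu c x - conc nu c (- x).

Definition energy nu c : R := \int[nu]_x excess nu c x.

Lemma measurable_excess nu c : measurable_fun setT (excess nu c).
Proof.
apply: measurable_funB.
  by apply: measurable_funM => //; exact: measurable_conc.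
by apply: measurableT_comp; [exact: measurable_conc|exact: oppr_measurable].
Qed.

Lemma excess_le2 nu c x : `|excess nu c x| <= 2.
Proof.
have := (conc_ge0 nu c x, conc_le1 nu c x, conc_ge0 nu c (- x), conc_le1 nu c (- x)).
by rewrite ler_norml /excess => -[[[? ?] ?] ?]; apply/andP; split; lra.
Qed.

Lemma integrable_conc nu r : nu.-integrable setT (EFin \o conc nu r).
Proof.
apply: (@bounded_integrable _ _ _ _ _ 1) => [|x]; first exact: measurable_conc.
by rewrite ger0_norm ?conc_ge0// conc_le1.
Qed.

Lemma integrable_excess nu c : nu.-integrable setT (EFin \o excess nu c).
Proof.
apply: (@bounded_integrable _ _ _ _ _ 2); first exact: measurable_excess.
exact: excess_le2.
Qed.

Lemma Rintegral_indic nu A : measurable A -> \int[nu]_x \1_A x = fine (nu A).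
Proof. by move=> mA; rewrite /Rintegral integral_indic// setIT. Qed.

Lemma integrable_indic nu A : measurable A -> nu.-integrable setT (EFin \o \1_A).
Proof.
move=> mA; apply: (@bounded_integrable _ _ _ _ _ 1) => // x.
by rewrite indicE; case: (_ \in _); rewrite ?normr1 ?normr0.
Qed.

Lemma energyE nu c :
  energy nu c = 2 * \int[nu]_x conc nu c x - \int[nu]_x conc nu c (- x).
Proof.
rewrite /energy RintegralB//.
- by rewrite RintegralZl//; exact: integrable_conc.
- apply: (@bounded_integrable _ _ _ _ _ 2) => [|x].
    by apply: measurable_funM => //; exact: measurable_conc.
  by rewrite normrM !ger0_norm ?conc_ge0// ler_piMr// conc_le1.
- apply: (@bounded_integrable _ _ _ _ _ 1) => [|x].
    by apply: measurableT_comp; [exact: measurable_conc|exact: oppr_measurable].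
  by rewrite ger0_norm ?conc_ge0// conc_le1.
Qed.

Section perturbation.
Variables (e : R) (e0 : 0 <= e) (e1 : 0 <= 1 - e) (nu : probability R R) (c a : R).
Let rho : probability R R := mixture e0 e1 nu a.

(* The kernel K(x, a) of the quadratic form, which is symmetric. *)
Let point x : R := 2 * \1_(window a c) x - \1_(window (- a) c) x.

(* The potential is affine in the probability, and K(., a) is the potential of the
   point mass at a. *)
Let excess_mixture x : excess rho c x = (1 - e) * excess nu c x + e * point x.
Proof.
have indE z : (\1_(window x c) z : R) = \1_(window z c) x.
  by rewrite !indicE; congr ((_ : bool)%:R); apply/idP/idP;
    rewrite !inE /window /= distrC.
have indN z : (\1_(window (- x) c) z : R) = \1_(window (- z) c) x.
  by rewrite !indicE; congr ((_ : bool)%:R); apply/idP/idP;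
    rewrite !inE /window /= !opprK addrC.
rewrite /excess /conc !mixtureE// /point !indE !indN.
by ring.
Qed.

(* By symmetry of K, integrating it against nu gives the potential of nu; this is
   what makes the two cross terms of the expansion equal. *)
Let Rintegral_point : \int[nu]_x point x = excess nu c a.
Proof.
rewrite RintegralB//.
- by rewrite RintegralZl// ?Rintegral_indic//; exact: integrable_indic.
- apply: (@bounded_integrable _ _ _ _ _ 2) => [|x]; first exact: measurable_funM.
  rewrite indicE; case: (_ \in _); rewrite ?mulr1 ?mulr0 ?normr0//.
  by rewrite ger0_norm.
- exact: integrable_indic.
Qed.

(** Expansion of the quadratic form at (1 - e) nu + e delta_a; the last term
bounds e^2 K(a, a), as K <= 2. *)
Lemma energy_mixture_le : energy rho c <=
  (1 - e) ^+ 2 * energy nu c + 2 * e * (1 - e) * excess nu c a + 2 * e ^+ 2.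
Proof.
have mpoint : measurable_fun setT point.
  by apply: measurable_funB => //; exact: measurable_funM.
have point_le2 x : `|point x| <= 2.
  rewrite /point !indicE ler_norml; apply/andP.
  by case: (_ \in _); case: (_ \in _); split=> /=; lra.
rewrite /energy.
rewrite (Rintegral_mixture _ _ _ _ (measurable_excess _ _) (excess_le2 _ _)).
under eq_Rintegral do rewrite excess_mixture.
rewrite RintegralD//; last 2 first.
- apply: (@bounded_integrable _ _ _ _ _ 2) => [|x].
    by apply: measurable_funM => //; exact: measurable_excess.
  rewrite normrM (ger0_norm e1) -[leRHS]mul1r.
  by apply: ler_pM; rewrite ?gerBl ?excess_le2.
- apply: (@bounded_integrable _ _ _ _ _ (e * 2)) => [|x].
    exact: measurable_funM.
  by rewrite normrM (ger0_norm e0) ler_wpM2l.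
rewrite !RintegralZl//; last 2 first.
- exact: integrable_excess.
- exact: (@bounded_integrable _ _ _ _ _ 2).
rewrite Rintegral_point excess_mixture.
have := point_le2 a; rewrite ler_norml => /andP[_ pa].
have e2 : e ^+ 2 * point a <= e ^+ 2 * 2 by rewrite ler_wpM2l// sqr_ge0.
rewrite [leLHS](_ : _ = (1 - e) ^+ 2 * \int[nu]_x excess nu c x
  + 2 * e * (1 - e) * excess nu c a + e ^+ 2 * point a); last by ring.
by rewrite lerD2l [leRHS]mulrC.
Qed.

End perturbation.

Lemma energy_ge nu c b : (forall x, b <= excess nu c x) -> b <= energy nu c.
Proof.
move=> bk; rewrite -[leLHS](Rintegral_prob_cst nu); apply: le_Rintegral => //.
  by apply: (@bounded_integrable _ _ _ _ _ `|b|).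
exact: integrable_excess.
Qed.

(** * The energy is nonnegative *)

Definition peak nu r : R := sup (range (conc nu r)).

Lemma conc_le_peak nu r m : conc nu r m <= peak nu r.
Proof.
apply: ub_le_sup; last by exists m.
by exists 1 => _ [x _ <-]; exact: conc_le1.
Qed.

Lemma peak_adherent nu r e : 0 < e -> exists m, peak nu r - e < conc nu r m.
Proof.
move=> e0; have [|_ [m _ <-] lt_m] := @sup_adherent _ (range (conc nu r)) e e0.
  split; first by exists (conc nu r 0), 0.
  by exists 1 => _ [x _ <-]; exact: conc_le1.
by exists m.
Qed.

Lemma conc_le_double_peak nu c z : conc nu c z <= 2 * peak nu (c / 2).
Proof.
have := conc_halves nu c z.
have := conc_le_peak nu (c / 2) (z - c / 2).
by have := conc_le_peak nu (c / 2) (z + c / 2); lra.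
Qed.

Lemma conc_window nu c m x : window m (c / 2) x -> conc nu (c / 2) m <= conc nu c x.
Proof. by rewrite /window /= => xm; apply: conc_sub; rewrite distrC; lra. Qed.

(** First-order condition at a near-minimiser: l stands for the infimum of the
energies, D < l + e^2 for the energy of a probability, and k for its excess at a
point. The infimum bounds the energy of the mixture with weight e, and comparing
the terms of order e bounds k from below. *)
Lemma excess_ge_of_near_min (e l D k : R) :
    0 < e -> e <= 1 / 5 -> - 2 <= l -> D < l + e ^+ 2 ->
    l <= (1 - e) ^+ 2 * D + 2 * e * (1 - e) * k + 2 * e ^+ 2 ->
  l - 5 * e <= k.
Proof.
move=> e0 e5 l2 De mix_ge; rewrite leNgt; apply/negP => k_lt.
have De' : (1 - e) ^+ 2 * D <= (1 - e) ^+ 2 * (l + e ^+ 2).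
  by rewrite ler_wpM2l ?sqr_ge0// ltW.
have ke : 2 * e * (1 - e) * k < 2 * e * (1 - e) * (l - 5 * e).
  by rewrite ltr_pM2l// !mulr_gt0//; lra.
have bracket : (1 - e) ^+ 2 - 10 * (1 - e) + 2 - l <= 0 by nra.
by have := mulr_ge0_le0 (sqr_ge0 e) bracket; nra.
Qed.

(** Numerical end of the argument below: F is the mass of a window of nearly
maximal mass, t the supremum of such masses, D the energy of a near-minimiser. The
bounds give F = O(e / |l|) and then l^2 = O(e), which the factor 20 in the choice
of e excludes. *)
Lemma infimum_contradiction (l F t D : R) (e := l ^+ 2 / 20) :
    - 2 <= l -> l < 0 -> 0 <= F -> t - e < F -> D < l + e ^+ 2 ->
    l - 5 * e - l * F <= D -> - 2 * t <= D -> False.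
Proof.
move=> l2 l0 F0 tF upper lower tD.
have e0 : 0 < e by rewrite /e; nra.
have e1 : e <= 1 / 5 by rewrite /e; nra.
have lF : - l * F <= 6 * e by nra.
have l3 : - l < 3 * e + 2 * F by nra.
have : l ^+ 2 < - l * (3 * e) + 12 * e by nra.
have : l ^+ 2 = 20 * e by rewrite /e; field.
by nra.
Qed.

(** No minimiser need exist, as probabilities on the line are not compact, so
the variational argument is run on a near-minimiser. *)
Lemma energy_ge0 nu c : 0 <= energy nu c.
Proof.
pose S := [set r | exists mu : probability R R, r = energy mu c].
have lbS : lbound S (- 2).
  move=> _ [mu ->]; apply: energy_ge => x.
  by have := excess_le2 mu c x; rewrite ler_norml => /andP[].
have infS : has_inf S by split; [exists (energy nu c), nu | exists (- 2)].
have inf_le mu : inf S <= energy mu c.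
  by apply: (ge_inf infS.2); exists mu.
have inf_ge : - 2 <= inf S by apply: (lb_le_inf infS.1).
have near_inf r : 0 < r -> exists mu : probability R R, energy mu c < inf S + r.
  by move=> /inf_adherent/(_ infS)[_ [mu ->] ?]; exists mu.
apply: le_trans (inf_le nu); rewrite leNgt; apply/negP.
(* Only these three properties of the infimum matter from here on. *)
move: (inf S) inf_le inf_ge near_inf => l inf_le inf_ge near_inf inf_lt0.
pose e := l ^+ 2 / 20.
have e_gt0 : 0 < e by rewrite /e; nra.
have e_lt : e <= 1 / 5 by rewrite /e; nra.
have e_ge0 := ltW e_gt0.
have e1 : 0 <= 1 - e by lra.
have [mu mu_lt] := near_inf _ (exprn_gt0 2 e_gt0).
have excess_ge x : l - 5 * e <= excess mu c x.
  apply: (excess_ge_of_near_min e_gt0 e_lt inf_ge mu_lt).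
  exact: le_trans (inf_le _) (energy_mixture_le e_ge0 e1 mu c x).
have [m m_peak] := peak_adherent mu (c / 2) e_gt0.
have excess_ge_peak x : - 2 * peak mu (c / 2) <= excess mu c x.
  rewrite /excess; have := conc_ge0 mu c x.
  by have := conc_le_double_peak mu c (- x); lra.
have energy_lower : l - 5 * e - l * conc mu (c / 2) m <= energy mu c.
  (* The excess is at least l - 5 e everywhere, and at least - 2 e on the window. *)
  pose g x := l - 5 * e + - l * \1_(window m (c / 2)) x.
  have ig : mu.-integrable setT (fun x => (- l * \1_(window m (c / 2)) x)%:E).
    apply: (@bounded_integrable _ _ _ _ _ (- l)) => [|x].
      exact: measurable_funM.
    rewrite indicE; case: (_ \in _); rewrite ?mulr1 ?mulr0 ?normr0; last by lra.
    by rewrite normrN ltr0_norm.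
  have ic : mu.-integrable setT (EFin \o cst (l - 5 * e)).
    by apply: (@bounded_integrable _ _ _ _ _ `|l - 5 * e|).
  have -> : l - 5 * e - l * conc mu (c / 2) m = \int[mu]_x g x.
    rewrite RintegralD// Rintegral_prob_cst RintegralZl//; last exact: integrable_indic.
    by rewrite Rintegral_indic// mulNr.
  apply: le_Rintegral => //; first exact: (integrableD measurableT ic ig).
    exact: integrable_excess.
  move=> x _; rewrite /g indicE.
  have [|_] := boolP (x \in window m (c / 2)); last by rewrite mulr0 addr0.
  rewrite inE => /(conc_window mu); rewrite /excess mulr1.
  by have := conc_le_double_peak mu c (- x); lra.
exact: (infimum_contradiction inf_ge inf_lt0 (conc_ge0 mu (c / 2) m) m_peak
  mu_lt energy_lower (energy_ge excess_ge_peak)).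
Qed.

(** * The largest concentration is attained *)

(** Upper semicontinuity: a closed window is the intersection of its enlargements,
and an enlargement contains the windows with nearby centers. *)
Lemma conc_near_lt nu r a b : conc nu r a < b ->
  \forall x \near a, conc nu r x < b.
Proof.
move=> ab.
have [|||n nb] := @prob_bigcap_lt _ _ _ nu (fun n => window a (r + n.+1%:R^-1)) b.
- by move=> n; exact: measurable_window.
- apply/nonincreasing_seqP => n; apply/subsetPset => y; rewrite /window /= => /le_trans.
  by apply; rewrite lerD2l lef_pV2 ?posrE// ler_nat.
- rewrite (_ : \bigcap_n _ = window a r)//; apply/seteqP; split => [y ay|y ay n _].
    rewrite /window /=; apply/ler_addgt0Pr => _/posnumP[e].
    have [n _ /(_ n (leqnn n)) /= ne] := near_infty_natSinv_lt e.
    by have := ay n I; rewrite /window /= => /le_trans; apply; rewrite lerD2l ltW.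
  by rewrite /window /= (le_trans ay)// lerDl.
have n0 : 0 < n.+1%:R^-1 :> R by rewrite invr_gt0.
near=> x.
apply: le_lt_trans nb; apply: conc_sub; rewrite addrAC subrr add0r distrC.
near: x; apply/nbhs_normP; exists n.+1%:R^-1 => //= y /=; exact: ltW.
Unshelve. all: end_near. Qed.

Lemma conc_tail_lt nu r b : 0 < b ->
  exists M : R, forall m : R, M < `|m| -> conc nu r m < b.
Proof.
move=> b0.
have mF n : measurable [set y : R | n%:R <= `|y|].
  have mf : measurable_fun setT (fun y : R => `|y|) by exact: normr_measurable.
  have := mf measurableT _ (measurable_itv `[n%:R, +oo[).
  by rewrite setTI set_itvE; congr measurable.
have [|||n nb] := @prob_bigcap_lt _ _ _ nu (fun n => [set y : R | n%:R <= `|y|]) b.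
- exact: mF.
- apply/nonincreasing_seqP => n; apply/subsetPset => y /=.
  by apply: le_trans; rewrite ler_nat.
- rewrite (_ : \bigcap_n _ = set0) ?measure0//; apply/seteqP; split => // y /= yn.
  have /(_ I) := yn (Num.truncn `|y|).+1.
  by rewrite /= leNgt truncnS_gt.
exists (n%:R + r) => m nm; apply: le_lt_trans nb.
apply: prob_mono; [exact: measurable_window|exact: mF|].
move=> y; rewrite /window /= => ym.
by have := ler_distD y m 0; rewrite !subr0 distrC; lra.
Qed.

Lemma conc_multiple nu r n z : conc nu (n.+1%:R * r) z <= n.+1%:R * peak nu r.
Proof.
elim: n z => [|n IHn] z; first by rewrite !mul1r conc_le_peak.
have cover : conc nu (n.+2%:R * r) z <=
    conc nu (n.+1%:R * r) (z - r) + conc nu r (z + n.+1%:R * r).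
  apply: prob_cover2 => // y; rewrite /window /= -[n.+2%:R]natr1 !mulrDl !mul1r.
  move: (n.+1%:R * r) => s; rewrite !ler_norml => /andP[zy yz].
  by have [?|?] := leP y (z + s - r); [left|right]; apply/andP; split; lra.
apply: le_trans cover _; rewrite -[n.+2%:R]natr1 [leRHS]mulrDl mul1r.
by apply: lerD; [exact: IHn|exact: conc_le_peak].
Qed.

(** If all windows of radius r were null, so would be the larger ones, which
exhaust the line. *)
Lemma peak_gt0 nu r : 0 < r -> 0 < peak nu r.
Proof.
move=> r0.
have [|||n nb] := @prob_bigcap_lt _ _ _ nu (fun n => ~` window 0 (n%:R * r)) 1.
- by move=> n; exact: measurableC.
- apply/nonincreasing_seqP => n; apply/subsetPset/subsetC => y.
  by rewrite /window /= => /le_trans; apply; rewrite ler_pM2r// ler_nat.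
- rewrite (_ : \bigcap_n _ = set0) ?measure0//; apply/seteqP; split => // y /= yn.
  apply: (yn (Num.truncn (`|y| / r)).+1 I).
  by rewrite /window /= subr0 -ler_pdivrMr// ltW// truncnS_gt.
have ge1 : 1 <= conc nu (n.+1%:R * r) 0 + fine (nu (~` window 0 (n%:R * r))).
  rewrite -[leLHS](congr1 (@fine R) (probability_setT nu)).
  apply: prob_cover2 => // [|y _]; first exact: measurableC.
  have [y_in|y_out] := pselect (window 0 (n%:R * r) y); [left|by right].
  by move: y_in; rewrite /window /= => /le_trans; apply; rewrite ler_pM2r// ler_nat.
have : 0 < n.+1%:R * peak nu r by have := conc_multiple nu r n 0; lra.
by rewrite pmulr_rgt0.
Qed.

(** An upper semicontinuous function that is small at infinity attains its
supremum: otherwise every point has a neighborhood on which a uniform gap below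
the supremum holds, and by compactness one gap serves all centers in [-M, M]. *)
Lemma peak_attained nu r : 0 < r -> exists m, conc nu r m = peak nu r.
Proof.
move=> r0; have t0 := peak_gt0 nu r0; set t := peak nu r in t0 *.
apply: contrapT => not_attained.
have conc_lt m : conc nu r m < t.
  rewrite lt_neqAle conc_le_peak andbT; apply/eqP => mt.
  by apply: not_attained; exists m.
have t2 : 0 < t / 2 by lra.
have [M tail] := conc_tail_lt nu r t2.
have cover : forall x, `[- M, M]%classic x ->
    \forall x' \near x & n \near \oo, conc nu r x' < t - n.+1%:R^-1.
  move=> x _; have gap : 0 < (t - conc nu r x) / 2 by have := conc_lt x; lra.
  have midpoint (f s : R) : f < (t + conc nu r x) / 2 ->
    s < (t - conc nu r x) / 2 -> f < t - s by lra.
  exists ([set x' | conc nu r x' < (t + conc nu r x) / 2],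
    [set n | n.+1%:R^-1 < (t - conc nu r x) / 2]).
    split; last exact: (near_infty_natSinv_lt (PosNum gap)).
    by apply: conc_near_lt; have := conc_lt x; lra.
  by move=> [x' n] [/= x'_lt n_lt]; exact: midpoint.
have /compact_near_coveringP covering := @segment_compact R (- M) M.
have [n _ /(_ n (leqnn n)) below] := covering _ _ _ _ cover.
have n0 : 0 < n.+1%:R^-1 :> R by rewrite invr_gt0.
have [e [e0 et en]] : exists e, [/\ 0 < e, e <= t / 2 & e <= n.+1%:R^-1].
  exists (Num.min (t / 2) n.+1%:R^-1).
  by split; rewrite ?lt_min ?n0 ?t2// ge_min lexx ?orbT.
have [m] := peak_adherent nu r e0; rewrite -/t => m_near.
have [/tail m_lt|m_in] := ltP M `|m|; first by lra.
have /below : `[- M, M]%classic m by rewrite /= in_itv /= -ler_norml.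
by move: (n.+1%:R^-1) en => s es m_lt; lra.
Qed.

(** The centers of windows of maximal mass form a compact set, by semicontinuity
and smallness at infinity. *)
Lemma peak_attained_far nu r : 0 < r -> exists2 m, conc nu r m = peak nu r &
  forall m', conc nu r m' = peak nu r -> `|m'| <= `|m|.
Proof.
move=> r0; have t0 := peak_gt0 nu r0.
pose C := [set m | peak nu r <= conc nu r m].
have [M tail] := conc_tail_lt nu r t0.
have closedC : closed C.
  rewrite (_ : C = ~` [set m | conc nu r m < peak nu r]); last first.
    by apply/seteqP; split => m /=; rewrite /C /= leNgt => /negP.
  apply: open_closedC; rewrite openE => m /= m_lt.
  exact: conc_near_lt.
have compactC : compact C.
  apply: (subclosed_compact closedC (@segment_compact R (- M) M)) => m Cm.
  rewrite /= in_itv /= -ler_norml leNgt; apply/negP => /tail.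
  by rewrite ltNge => /negP; apply.
have [m0 m0_peak] := peak_attained nu r0.
have C0 : C !=set0 by exists m0; rewrite /C /= m0_peak.
have normC : {within C, continuous (fun m : R => `|m|)}.
  by apply: continuous_subspaceT => m; exact: norm_continuous.
have [m] := compact_EVT_max C0 compactC normC.
rewrite inE /C /= => Cm far; exists m.
  by apply/eqP; rewrite eq_le Cm conc_le_peak.
by move=> m' m'_peak; apply: far; rewrite inE /= m'_peak.
Qed.

(** * The energy is positive *)

Section zero_energy.
Variables (nu : probability R R) (c : R).
Hypothesis energy0 : energy nu c = 0.

(** A probability of energy 0 minimises the energy, so the energy cannot decrease
to first order when a point mass is mixed in. *)
Lemma excess_ge0 x : 0 <= excess nu c x.
Proof.
rewrite leNgt; apply/negP => k_lt0.
have := excess_le2 nu c x; rewrite ler_norml => /andP[k_ge _].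
have mix e : 0 <= e -> 0 <= 1 - e ->
    0 <= 2 * e * (1 - e) * excess nu c x + 2 * e ^+ 2.
  move=> e0 e1; have := energy_mixture_le e0 e1 nu c x.
  rewrite energy0 mulr0 add0r; apply: le_trans; exact: energy_ge0.
(* For k < 0 the bound is negative at e = - k / 4, which is at most 1 / 2. *)
move: (excess nu c x) k_lt0 k_ge mix => k k_lt0 k_ge /(_ (- k / 4)).
by nra.
Qed.

(** The excess is nonnegative with integral 0, so it vanishes almost
everywhere. *)
Lemma null_of_excess_neq0 A : measurable A ->
  (forall x, A x -> excess nu c x <> 0) -> fine (nu A) = 0.
Proof.
move=> mA Ak.
have mk : measurable_fun setT (EFin \o excess nu c).
  by apply/measurable_EFinP; exact: measurable_excess.
have : (\int[nu]_x `|(EFin \o excess nu c) x| = 0)%E.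
  under eq_integral do rewrite /= ger0_norm ?excess_ge0//.
  rewrite -[LHS]fineK; last first.
    exact: (integrable_fin_num measurableT (integrable_excess nu c)).
  by rewrite -/(Rintegral _ _ _) -/(energy nu c) energy0.
move=> /(ae_eq_integral_abs _ measurableT mk) [N [mN N0 kN]].
suff : (nu A <= nu N)%E by rewrite N0 measure_le0 => /eqP ->.
apply: le_measure; rewrite ?inE// => x Ax.
by apply: kN => /(_ I) /= [] /(Ak _ Ax).
Qed.

End zero_energy.

(** Geometry of the extreme window: if x lies in the window of radius c / 2 around m
and neither half of the window of radius c around - x has its center further from
0 than m, then x is the endpoint of the window around m that is on the side of
0. *)
Lemma extreme_center (c m x : R) : `|x - m| <= c / 2 ->
    `|- x - c / 2| <= `|m| -> `|- x + c / 2| <= `|m| ->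
  (0 <= m -> x = m - c / 2) /\ (m <= 0 -> x = m + c / 2).
Proof.
rewrite ler_norml => /andP[xm mx] lo hi; split => m0; move: lo hi.
  by rewrite !ler_norml !(ger0_norm m0) => /andP[? ?] /andP[? ?]; lra.
by rewrite !ler_norml !(ler0_norm m0) => /andP[? ?] /andP[? ?]; lra.
Qed.

(** At energy 0 the mass of an extreme window of maximal mass has to sit at one
endpoint, which also belongs to another window of maximal mass; the two together
cover a window that would need twice the maximal mass. *)
Lemma energy_gt0 nu c : 0 < c -> 0 < energy nu c.
Proof.
move=> c0; rewrite lt_neqAle energy_ge0 andbT; apply/eqP => /esym energy0.
have h0 : 0 < c / 2 by lra.
have t0 := peak_gt0 nu h0.
have [m m_peak far] := peak_attained_far nu h0.
set t := peak _ _ in t0 m_peak far.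
(* Zero excess in a window of maximal mass makes both halves around - x maximal. *)
have tight z x : conc nu (c / 2) z = t -> window z (c / 2) x ->
    excess nu c x = 0 ->
    conc nu (c / 2) (- x - c / 2) = t /\ conc nu (c / 2) (- x + c / 2) = t.
  rewrite /excess => z_peak /(conc_window nu); rewrite z_peak => conc_x k0.
  have := conc_halves nu c (- x).
  have := conc_le_peak nu (c / 2) (- x - c / 2).
  have := conc_le_peak nu (c / 2) (- x + c / 2); rewrite -/t.
  by split; lra.
have nonnull z : conc nu (c / 2) z = t ->
    exists2 x, window z (c / 2) x & excess nu c x = 0.
  move=> z_peak; apply: contrapT => no_x.
  move: t0; rewrite -z_peak /conc (null_of_excess_neq0 energy0) ?ltxx// => x zx k0.
  by apply: no_x; exists x.
have forced z x : `|z| = `|m| -> conc nu (c / 2) z = t -> window z (c / 2) x ->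
    excess nu c x = 0 -> (0 <= z -> x = z - c / 2) /\ (z <= 0 -> x = z + c / 2).
  move=> zm z_peak zx k0; have [lo hi] := tight _ _ z_peak zx k0.
  by apply: extreme_center; [exact: zx|rewrite zm; exact: far..].
have [x0 mx0 k0] := nonnull _ m_peak.
have [lo hi] := tight _ _ m_peak mx0 k0.
have [x0_pos x0_neg] := forced _ _ erefl m_peak mx0 k0.
have opp_peak : conc nu (c / 2) (- m) = t.
  have [m0|m0] := leP 0 m.
    by rewrite -lo (x0_pos m0); congr conc; lra.
  by rewrite -hi (x0_neg (ltW m0)); congr conc; lra.
have atom y : window (- m) (c / 2) y -> excess nu c y = 0 -> y = - x0.
  move=> my ky.
  have [y_pos y_neg] := forced _ _ (normrN m) opp_peak my ky.
  have [m0|m0] := leP 0 m.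
    by rewrite (x0_pos m0) y_neg ?oppr_le0//; lra.
  by rewrite (x0_neg (ltW m0)) y_pos ?oppr_ge0 ?ltW//; lra.
(* The window around z is the other half of the window around - x0, and contains
   - x0, so that this point can be removed from the half around - m. *)
have [z z_peak cover] : exists2 z, conc nu (c / 2) z = t &
    window (- x0) c `<=` (window (- m) (c / 2) `\ - x0) `|` window z (c / 2).
  have near_x0 (y : R) : y = - x0 -> `|y - (- x0 - c / 2)| <= c / 2 /\
      `|y - (- x0 + c / 2)| <= c / 2.
    by move=> ->; rewrite !ler_norml; split; apply/andP; split; lra.
  have [m0|m0] := leP 0 m.
    exists (- x0 + c / 2) => // y /window_halves.
    rewrite (_ : - x0 - c / 2 = - m); last by rewrite (x0_pos m0); lra.
    have [->|/eqP yx0] := eqVneq y (- x0); first by right; case: (near_x0 _ erefl).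
    by case; [left|right].
  exists (- x0 - c / 2) => // y /window_halves.
  rewrite (_ : - x0 + c / 2 = - m); last by rewrite (x0_neg (ltW m0)); lra.
  have [->|/eqP yx0] := eqVneq y (- x0); first by right; case: (near_x0 _ erefl).
  by case; [right|left].
have : 2 * t <= conc nu c (- x0).
  have := conc_window nu mx0; rewrite m_peak => conc_x0.
  by move: k0; rewrite /excess; lra.
have : conc nu c (- x0) <= 0 + t.
  rewrite -z_peak -(null_of_excess_neq0 energy0 (A := window (- m) (c / 2) `\ - x0)).
  - by apply: prob_cover2 => //; exact: measurableD.
  - exact: measurableD.
  by move=> y [my yx0] /(atom _ my).
by lra.
Qed.

End concentration.

(** * Back to random variables *)

Section iid_pair.
Context {R : realType} {d : measure_display} {T : measurableType d}.
Variables (P : probability T R) (X Y : {RV P >-> R}).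
Hypotheses (hindep : independent_RV2 X Y) (hid : identically_distributed X Y).

Let nu : probability R R := distribution P X.

(** Independence makes the law of the pair agree with the product of the laws on
rectangles, hence everywhere; then Fubini. *)
Lemma iid_pair_law (E : set (R * R)) : measurable E ->
  P [set w | E (X w, Y w)] = (\int[nu]_x fine (nu (xsection E x)))%:E.
Proof.
move=> mE; have mXY : measurable_fun setT (fun w => (X w, Y w)).
  exact: measurable_fun_pair.
pose joint : {measure set (R * R) -> \bar R} :=
  pushforward P (fun w => (X w, Y w)).
have joint_rect (A B : set R) : measurable A -> measurable B ->
    joint mXY (A `*` B) = (nu A * nu B)%E.
  move=> mA mB; transitivity (P (X @^-1` A) * P (Y @^-1` B))%E.
    exact: hindep.
  by congr (_ * _)%E; exact/esym/hid.
have <- : (nu \x nu)%E E = P [set w | E (X w, Y w)].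
  exact: (product_measure_unique joint_rect).
have msec x : measurable (xsection E x) by exact: measurable_xsection.
rewrite /product_measure1 /Rintegral fineK.
  by apply: eq_integral => x _; rewrite prob_fineK.
apply: integrable_fin_num => //; apply: (@bounded_integrable _ _ _ _ _ 1).
  apply: measurableT_comp; first exact: fine_measurable.
  exact: measurable_fun_xsection.
by move=> x; rewrite ger0_norm ?prob_ge0// prob_le1.
Qed.

Lemma iid_diff_le c : P [set w | `|X w - Y w| <= c] = (\int[nu]_x conc nu c x)%:E.
Proof.
rewrite (iid_pair_law (E := [set p | `|p.1 - p.2| <= c])).
  congr (_%:E); apply: eq_Rintegral => x _; rewrite xsectionE /conc.
  by congr (fine (nu _)); apply/seteqP; split => y; rewrite /window /= distrC.
apply: measurable_norm_le.
by apply: measurable_funB; [exact: measurable_fst|exact: measurable_snd].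
Qed.

Lemma iid_sum_le c :
  P [set w | `|X w + Y w| <= c] = (\int[nu]_x conc nu c (- x))%:E.
Proof.
rewrite (iid_pair_law (E := [set p | `|p.1 + p.2| <= c])).
  congr (_%:E); apply: eq_Rintegral => x _; rewrite xsectionE /conc.
  by congr (fine (nu _)); apply/seteqP; split => y; rewrite /window /= opprK addrC.
apply: measurable_norm_le.
by apply: measurable_funD; [exact: measurable_fst|exact: measurable_snd].
Qed.

End iid_pair.

Theorem theorem1 (R : realType) (d : measure_display) (T : measurableType d)
    (P : probability T R) (X Y : {RV P >-> R})
    (hindep : independent_RV2 X Y) (hid : identically_distributed X Y)
    (c : R) (hc : 0 < c) :
  (P [set w | (`|X w + Y w| <= c)%R] < 2%:E * P [set w | (`|X w - Y w| <= c)%R])%E.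
Proof.
rewrite (iid_diff_le hindep hid) (iid_sum_le hindep hid) -EFinM lte_fin -subr_gt0.
have := energy_gt0 (distribution P X) hc.
by rewrite energyE.
Qed.
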